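(* Suppose $n=2^m-1$ for some integer $m\ge 0$. For $k\ge 0$ let $A_{n,k}(1)=[t^k]M_n(1,t)$ be the coefficient of $t^k$ in $M_n(1,t)$, i.e. the number of permutations $\sigma\in\mathrm{Av}_n(321)$ with $\mathrm{des}\,\sigma=k$. Then $A_{n,0}(1)=1$, and $A_{n,k}(1)$ is an even integer for every $k\ge 1$.
   Context: Let $\mathfrak S_n$ be the symmetric group of permutations $\sigma=b_1\ldots b_n$ (in one-line notation) of $[n]=\{1,\ldots,n\}$; $\mathfrak S_0$ consists of the empty permutation. Let $\mathrm{Av}_n(321)$ be the set of $\sigma=b_1\ldots b_n\in\mathfrak S_n$ avoiding the pattern $321$, i.e. such that there are no indices $i<j<l$ with $b_i>b_j>b_l$. For $\sigma=b_1\ldots b_n$ let $\mathrm{Des}\,\sigma=\{i \mid 1\le i\le n-1,\ b_i>b_{i+1}\}$, $\mathrm{des}\,\sigma=\#\mathrm{Des}\,\sigma$ (number of descents), and $\mathrm{maj}\,\sigma=\sum_{i\in\mathrm{Des}\,\sigma} i$ (major index). Define $M_n(q,t)=\sum_{\sigma\in\mathrm{Av}_n(321)}q^{\mathrm{maj}\,\sigma}t^{\mathrm{des}\,\sigma}$ and let $A_{n,k}(q)$ be the coefficient of $t^k$ in $M_n(q,t)$. The integer $0$ counts as even. *)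

(* Defs.v *)
From mathcomp Require Import all_boot all_fingroup all_algebra.

Set Implicit Arguments.
Unset Strict Implicit.
Unset Printing Implicit Defensive.

Import GRing.Theory.
Local Open Scope ring_scope.

(* A permutation b_1 ... b_n is an element s of 'S_n, with positions and values
   shifted down to {0, ..., n-1}: b_(i+1) = s i + 1.                          *)

Definition avoids321 (n : nat) (s : 'S_n) : bool :=
  ~~ [exists i : 'I_n, exists j : 'I_n, exists l : 'I_n,
       [&& (i < j)%N, (j < l)%N, (s j < s i)%N & (s l < s j)%N]].

Definition Av321 (n : nat) : {set 'S_n} := [set s | avoids321 s].

(* i : 'I_n encodes the 1-based position i.+1; the last one is never a descent
   because there is no j : 'I_n with value i.+1.                              *)
Definition Des (n : nat) (s : 'S_n) : {set 'I_n} :=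
  [set i : 'I_n | [exists j : 'I_n, (nat_of_ord j == i.+1) && (s j < s i)%N]].

Definition des (n : nat) (s : 'S_n) : nat := #|Des s|.

Definition maj (n : nat) (s : 'S_n) : nat := (\sum_(i in Des s) i.+1)%N.

(* M_n(q,t) as an element of Z[q][t]: the outer variable is t, the inner q. *)
Definition M (n : nat) : {poly {poly int}} :=
  \sum_(s in Av321 n) ('X^(maj s))%:P * 'X^(des s).

Definition A (n k : nat) : {poly int} := (M n)`_k.

Lemma A_at1_coef (n k : nat) :
  (A n k).[1] = (map_poly (horner_eval (1 : int)) (M n))`_k.
Proof. by rewrite coef_map. Qed.

Lemma A_at1_card (n k : nat) :
  (A n k).[1] = #|[set s in Av321 n | des s == k]|%:Z.
Proof.
rewrite /A /M coef_sum horner_sum -sum1_card -natz natr_sum.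
rewrite (eq_bigl (fun s => (s \in Av321 n) && (des s == k))); last first.
  by move=> s; rewrite inE.
rewrite big_mkcondr /=; apply: eq_bigr => s _.
rewrite coefCM coefXn eq_sym; case: eqP => _; last by rewrite mulr0 horner0.
by rewrite mulr1 hornerXn expr1n.
Qed.

(* Main.v *)
(* Inserting the largest letter into a 321-avoiding permutation keeps it
   321-avoiding exactly when it lands weakly to the right of the last descent.
   Hence the descent polynomials Q_n(m) of the 321-avoiders of [n] whose descents
   are all at most m satisfy, for 1 <= m <= n
   and with Q_n(-1) = 1,
     Q_(n+1)(m) = Q_(n+1)(m-1) + Q_n(m) + (t-1) Q_n(m-2),
   a weighted ballot recurrence with an explicit solution.  For m = n it gives
     M_n(1,t) = sum_k C(n-k,k) Cat(n-k) (t-1)^k.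
   Cat(j) is odd only for j of the form 2^i - 1.  For n = 2^p - 1 and
   1 <= k <= n-k, the index n-k lies strictly between 2^(p-1) - 1 and 2^p - 1,
   so Cat(n-k) is even and M_n(1,t) is constant mod 2. *)
Require Import Defs.
From mathcomp Require Import all_boot all_fingroup all_algebra.
From mathcomp Require Import zify ring.

Set Implicit Arguments.
Unset Strict Implicit.
Unset Printing Implicit Defensive.

Import GRing.Theory.
Local Open Scope ring_scope.

(** * Ballot numbers in closed form *)

(* ballot a r is the coefficient of z^a in C(z)^r, C the Catalan series; in
   particular ballot a 1 is the Catalan number Cat(a). *)
Fixpoint ballot (a : nat) : nat -> nat :=
  if a is a'.+1 then
    fix ballot_a r := if r is r'.+1 then (ballot_a r' + ballot a' r'.+2)%N else 0%N
  else fun=> 1%N.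
Arguments ballot : simpl never.

Lemma ballotS0 a : ballot a.+1 0 = 0%N. Proof. by []. Qed.

Lemma ballotS a r :
  ballot a.+1 r.+1 = (ballot a.+1 r + ballot a r.+2)%N.
Proof. by []. Qed.

(** Reflection formula, by induction from the ballot recurrence and Pascal's rule; it is stated
    additively because subtraction on [nat] truncates. *)
Lemma ballot_bin a r :
  (ballot a.+1 r + 'C(a.*2 + r.+1, a) = 'C(a.*2 + r.+1, a.+1))%N.
Proof.
elim: a r => [|a IHa]; elim=> [|r IHr] //.
- move: IHr; rewrite ballotS !add0n !bin0 !bin1 => IHr.
  rewrite -[ballot 0 _]/1%N; lia.
(* At [r = 0] the two binomials are the equal middle entries of an odd row. *)
- rewrite /= add0n -bin_sub; last by lia.
  by congr 'C(_, _); lia.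
- have := IHa r.+2; move: IHr.
  have -> : (a.+1.*2 + r.+2 = (a.*2 + r.+3).+1)%N by lia.
  have -> : (a.+1.*2 + r.+1 = a.*2 + r.+3)%N by lia.
  by rewrite (ballotS a.+1 r) !binS; lia.
Qed.

(** * Parity of binomial and Catalan numbers *)

(** This is (1+X)^2 = 1+X^2 modulo 2. *)
Lemma odd_binSS n k :
  odd 'C(n.+2, k.+2) = odd 'C(n, k.+2) (+) odd 'C(n, k).
Proof. by rewrite !binS !oddD; do 3 case: odd. Qed.

Lemma odd_bin_double n k : odd 'C(n.*2, k.*2) = odd 'C(n, k).
Proof.
elim: n k => [|n IHn] [|k]; rewrite ?bin0 ?bin0n //.
by rewrite !doubleS odd_binSS -doubleS !IHn binS oddD.
Qed.

Lemma odd_bin_double_odd n k : odd 'C(n.*2, k.*2.+1) = false.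
Proof.
elim: n k => [|n IHn] [|k]; rewrite ?bin0n ?bin1 ?odd_double //.
by rewrite !doubleS odd_binSS -doubleS !IHn.
Qed.

Lemma odd_bin_middle n : odd 'C(n.+1.*2, n.+1) = false.
Proof.
have -> : (n.+1.*2 = (n + n.+1).+1)%N by lia.
rewrite binS oddD -bin_sub; last by lia.
by rewrite addnK addbb.
Qed.

Lemma odd_catalan_double i : odd (ballot i.+1.*2 1) = false.
Proof.
have := congr1 odd (ballot_bin i.*2.+1 1).
have -> : (i.*2.+1.*2 + 2 = i.+1.*2.*2)%N by lia.
rewrite -doubleS oddD odd_bin_double_odd odd_bin_double.
by rewrite odd_bin_middle addbF.
Qed.

(** Modulo 2 both sides reduce to C(2i+1, i), since central binomials of positive rank are even. *)
Lemma odd_catalan_doubleS i : odd (ballot i.*2.+1 1) = odd (ballot i 1).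
Proof.
have := congr1 odd (ballot_bin i.*2 1).
have -> : (i.*2.*2 + 2 = i.*2.+1.*2)%N by lia.
rewrite oddD odd_bin_middle odd_bin_double.
case: i => [|i] //.
have := congr1 odd (ballot_bin i 1).
have -> : (i.*2 + 2 = i.+1.*2)%N by lia.
by rewrite oddD odd_bin_middle binS oddD odd_bin_middle; do 3 case: odd.
Qed.

(** An odd [j] passes to [j./2], which meets the same bounds for [m - 1]; an even [j] is positive by
    the lower bound, and Cat(j) is then even. *)
Lemma odd_catalan m j :
  (j < 2 ^ m - 1 <= j.*2)%N -> odd (ballot j 1) = false.
Proof.
elim: m j => [|m IHm] j; first by rewrite expn0.
rewrite expnS mul2n; set N := (2 ^ m)%N in IHm * => hj.
have [oj|ej] := boolP (odd j).
  have -> : j = (j./2).*2.+1 by lia.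
  by rewrite odd_catalan_doubleS IHm //; lia.
have -> : j = (j./2.-1).+1.*2 by lia.
exact: odd_catalan_double.
Qed.

(** * Explicit solution of the ballot recurrence *)

(* 'C(a, k - 1), with value 0 instead of 'C(a, 0) when k = 0. *)
Definition bin_pred (a k : nat) : nat := if k is k'.+1 then 'C(a, k') else 0.

Lemma binS_pred a k : 'C(a.+1, k) = ('C(a, k) + bin_pred a k)%N.
Proof. by case: k => [|k]; rewrite ?bin0. Qed.

(* Coefficient of (t-1)^k in Q_n(m), where r = n - m and a = m - k. *)
Definition runcoef (r a k : nat) : nat :=
  ballot a r.+1 * 'C(a, k) + ballot a.+1 r * bin_pred a k.

Section Runpoly.
Variables (R : comNzRingType) (x : R).

(** Candidate for Q_(m+r)(m), with [x] standing for t-1. *)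
Definition runpoly (r m : nat) : R :=
  \sum_(k < m.+1) (runcoef r (m - k) k)%:R * x ^+ k.

Lemma runpoly0 r : runpoly r 0 = 1.
Proof. by rewrite /runpoly big_ord1 expr0 mulr1 /runcoef bin0 /= muln0 addn0. Qed.

Lemma runcoef0SS r k : runcoef r 0 k.+2 = 0%N.
Proof. by rewrite /runcoef /bin_pred !bin0n !muln0. Qed.

(** The ballot recurrence expands the first factors, Pascal's rule the second ones. *)
Lemma runcoefS r a k :
  runcoef r.+1 a.+1 k.+1 =
  (runcoef r.+2 a k.+1 + runcoef r a.+1 k.+1 + runcoef r.+2 a k)%N.
Proof.
rewrite /runcoef (ballotS a.+1 r) (ballotS a r.+1) -[bin_pred a.+1 _]/'C(_, _).
rewrite -[bin_pred a k.+1]/'C(a, k) !binS_pred -[bin_pred a k.+1]/'C(a, k).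
by ring.
Qed.

Lemma runcoefS0 r a :
  runcoef r.+1 a.+1 0 = (runcoef r.+2 a 0 + runcoef r a.+1 0)%N.
Proof. by rewrite /runcoef !bin0 (ballotS a r.+1) /=; ring. Qed.

Lemma runpoly1 r : runpoly r 1 = r.+1%:R + r%:R * x.
Proof.
have ballot1 k : ballot 1 k = k by elim: k => // k; rewrite ballotS => ->; rewrite addn1.
rewrite /runpoly !big_ord_recr big_ord0 /= /runcoef !bin0 !bin0n /=.
rewrite subnn !ballot1 bin0.
by rewrite !muln0 !muln1 add0r addn0 mulr1.
Qed.

Lemma runpolyS r m :
  runpoly r.+1 m.+1 = runpoly r.+2 m + runpoly r m.+1
                      + x * (if m is m'.+1 then runpoly r.+2 m' else 1).
Proof.
case: m => [|m].
  by rewrite !runpoly1 runpoly0 -!natr1; ring.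
rewrite /runpoly [LHS]big_ord_recr [X in _ + X + _]big_ord_recr /=.
(* The top terms have [a = 0] and [k >= 2], so they vanish; splitting off [k = 0] then aligns all
   the sums. *)
rewrite subnn !runcoef0SS !mul0r !addr0 mulr_sumr [LHS]big_ord_recl.
rewrite [X in X + _ + _]big_ord_recl [X in _ + X + _]big_ord_recl /=.
rewrite !subn0 runcoefS0 natrD mulrDl addrACA -!addrA; congr (_ + (_ + _)).
rewrite addrA -!big_split; apply: eq_bigr => k _ /=.
rewrite /bump /= !add1n subSS.
have -> : (m.+1 - k = (m - k).+1)%N by have := ltn_ord k; lia.
by rewrite subSS runcoefS !natrD exprS; ring.
Qed.

(** Counterpart of Q_n(n) = Q_n(n-1): position n is never a descent. *)
Lemma runpoly_diag m : runpoly 0 m.+1 = runpoly 1 m.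
Proof.
rewrite /runpoly big_ord_recr /= subnn {2}/runcoef /= bin0n muln0 mul0r addr0.
apply: eq_bigr => k _; rewrite subSn; last by rewrite -ltnS.
congr (_%:R * _); rewrite /runcoef binS_pred !ballotS.
by rewrite !ballotS0 mul0n addn0 !add0n mulnDr.
Qed.

End Runpoly.

(** * Insertion of the largest letter *)

(* Positions are 0-based; out-of-range positions get the junk letter 0. *)
Definition letter (n : nat) (s : 'S_n) (k : nat) : nat :=
  if insub k is Some i then s i else 0.

Lemma letter_ord n (s : 'S_n) (i : 'I_n) : letter s i = s i.
Proof. by rewrite /letter valK. Qed.

Lemma letter_lt n (s : 'S_n) k : (k < n)%N -> (letter s k < n)%N.
Proof. by move=> kn; rewrite -[k]/(val (Ordinal kn)) letter_ord. Qed.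

Lemma letter_lift n (s : 'S_n) (i : 'I_n.+1) k : (k <= n)%N ->
  letter (lift_perm i ord_max s) k =
  if (k < i)%N then letter s k else if k == i then n else letter s k.-1.
Proof.
rewrite -ltnS => kn; rewrite -[k in LHS]/(val (Ordinal kn)) letter_ord.
case: (unliftP i (Ordinal kn)) => [j|] /[dup] /(congr1 val) /= def_k ->.
  rewrite lift_perm_lift lift_max -letter_ord {}def_k /bump.
  case: (leqP i j) => ij; last by rewrite add0n ij.
  by rewrite add1n ltnNge (leqW ij) gtn_eqF.
by rewrite lift_perm_id def_k ltnn eqxx.
Qed.

(* The 0-based k is the paper's descent k+1. *)
Definition descent (n : nat) (s : 'S_n) (k : nat) : bool :=
  (k.+1 < n)%N && (letter s k.+1 < letter s k)%N.

Lemma descent_lt n (s : 'S_n) k : descent s k -> (k.+1 < n)%N.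
Proof. by case/andP. Qed.

Lemma mem_Des n (s : 'S_n) (i : 'I_n) : (i \in Des s) = descent s i.
Proof.
rewrite inE; apply/existsP/andP => [[j /andP[/eqP ij sji]]|[i1n sji]].
  by rewrite -ij ltn_ord !letter_ord.
by exists (Ordinal i1n); rewrite -!letter_ord eqxx.
Qed.

Lemma des_sum n (s : 'S_n) : des s = (\sum_(k < n) descent s k)%N.
Proof.
rewrite /des -sum1_card big_mkcond; apply: eq_bigr => i _.
by rewrite mem_Des; case: descent.
Qed.

Lemma avoids321P n (s : 'S_n) :
  reflect (forall i j l, i < j -> j < l -> l < n ->
             letter s j < letter s i -> letter s l < letter s j -> False)%N
          (avoids321 s).
Proof.
apply: (iffP idP) => [av i j l ij jl ln sji slj | av].
  have jn := ltn_trans jl ln; have iN := ltn_trans ij jn.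
  case/negP: av; apply/existsP; exists (Ordinal iN).
  apply/existsP; exists (Ordinal jn); apply/existsP; exists (Ordinal ln).
  by rewrite -!letter_ord ij jl sji.
apply/negP => /existsP[i /existsP[j /existsP[l /and4P[ij jl]]]].
by rewrite -!letter_ord; apply: av.
Qed.

(** With 1-based positions, this bounds every descent by [m] inclusively. *)
Definition desc_below (n : nat) (s : 'S_n) (m : nat) : bool :=
  [forall k : 'I_n, descent s k ==> (k < m)%N].

Lemma desc_belowP n (s : 'S_n) m :
  reflect (forall k, descent s k -> (k < m)%N) (desc_below s m).
Proof.
apply: (iffP forallP) => [h k dk | h k]; last by apply/implyP/h.
have kn : (k < n)%N by apply: ltnW (descent_lt dk).
exact: (implyP (h (Ordinal kn))).
Qed.

Lemma descent_lift n (s : 'S_n) (i : 'I_n.+1) k :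
  descent (lift_perm i ord_max s) k =
  if (k < i)%N then descent s k && (k.+1 != i)
  else if k == i then (i < n)%N else descent s k.-1.
Proof.
rewrite /descent ltnS.
have [kn|nk] := leqP k.+1 n; last first.
  by have := ltn_ord i; do ?case: ifP; lia.
rewrite !letter_lift //; last exact: ltnW.
have sk := letter_lt s kn; have in1 := ltn_ord i.
case: (ltnP k i) => [ki|ik].
  case: (ltnP k.+1 i) => [k1i|ik1]; first by rewrite neq_ltn k1i /= andbT; lia.
  have -> : k.+1 = i by lia.
  by rewrite eqxx !andbF; lia.
have -> : (k.+1 < i)%N = false by lia.
have -> : (k.+1 == i) = false by lia.
have [ki|ki] := eqVneq k i; first by rewrite -ki sk kn.
by case: k ki kn sk ik => [|k] /=; lia.
Qed.

Lemma letter_homo n (s : 'S_n) m a c : desc_below s m ->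
  (m <= a <= c)%N -> (c < n)%N -> (letter s a <= letter s c)%N.
Proof.
move=> /desc_belowP dm /andP[ma ac]; rewrite -(subnKC ac).
elim: (c - a)%N => [|d IHd]; first by rewrite addn0.
rewrite addnS => dn; apply: leq_trans (IHd (ltnW dn)) _.
rewrite leqNgt; apply/negP => lt.
by have := dm (a + d)%N; rewrite /descent dn lt; lia.
Qed.

(** The new maximum can only play the 3 of a pattern 321, and it does so exactly when some descent
    of [s] lies at or after [i]. *)
Lemma avoids321_lift n (s : 'S_n) (i : 'I_n.+1) :
  avoids321 (lift_perm i ord_max s) = avoids321 s && desc_below s i.
Proof.
have iN := ltn_ord i.
apply/idP/andP => [/avoids321P av | [/avoids321P av dm]].
  have letter_bump k : (k < n)%N ->
      letter (lift_perm i ord_max s) (bump i k) = letter s k.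
    move=> kn; rewrite letter_lift /bump; last by case: leqP; lia.
    case: (leqP i k) => ik; last by rewrite add0n ik.
    by rewrite add1n ltnNge (leqW ik) gtn_eqF.
  split; last first.
    apply/desc_belowP => k dk; rewrite ltnNge; apply/negP => ik.
    have /andP[k1n lk] := dk; have kn := ltnW k1n; have lkn := letter_lt s kn.
    apply: (av i (bump i k) (bump i k.+1)); rewrite ?letter_bump //.
    - by rewrite /bump ik; lia.
    - by rewrite /bump; case: leqP; case: leqP; lia.
    - by rewrite /bump; case: leqP; lia.
    - by rewrite letter_lift ?ltnn ?eqxx // -ltnS.
  apply/avoids321P => a b c ab bc cn lba lcb.
  apply: (av (bump i a) (bump i b) (bump i c)); rewrite ?letter_bump //.
  - by rewrite /bump; case: leqP; case: leqP; lia.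
  - by rewrite /bump; case: leqP; case: leqP; lia.
  - by rewrite /bump; case: leqP; lia.
  - by lia.
  - by lia.
  - by lia.
apply/avoids321P => a b c ab bc cn; rewrite !letter_lift; [|lia..].
have letter_n k : (k < n)%N -> (letter s k < n)%N by exact: letter_lt.
have [bi|ib|bi] := ltngtP b i; last first.
- have -> : (a < i)%N by lia.
  by have := letter_n a; lia.
- have -> : (c < i)%N = false by lia.
  have -> : (c == i) = false by lia.
  have [ai|ia|ai] := ltngtP a i => lba lcb.
  + by apply: (av a b.-1 c.-1); lia.
  + by apply: (av a.-1 b.-1 c.-1); lia.
  (* Here the maximum is the 3, but the letters after it increase. *)
  + have := @letter_homo _ s i b.-1 c.-1 dm; lia.
- have -> : (a < i)%N by lia.
  have [ci|ic|ci] := ltngtP c i => lba lcb.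
  + by apply: (av a b c); lia.
  + by apply: (av a b c.-1); lia.
  + by have := letter_n b; lia.
Qed.

Definition descent_pred (n : nat) (s : 'S_n) (i : nat) : bool :=
  if i is i'.+1 then descent s i' else false.

(** Inserting at [i < n] creates a descent at [i] and destroys one at [i - 1], if present; inserting
    at the end changes nothing. *)
Lemma des_lift n (s : 'S_n) (i : 'I_n.+1) : desc_below s i ->
  (des (lift_perm i ord_max s) + descent_pred s i = des s + (i < n))%N.
Proof.
move=> /desc_belowP dm; have iN := ltn_ord i.
have descent_n k : (n <= k.+1)%N -> descent s k = false.
  by move=> nk; apply/negP => /descent_lt; lia.
have -> : (des s = \sum_(k < n.+1) descent s k)%N.
  by rewrite des_sum big_ord_recr /= descent_n ?addn0 // leqW.
have -> : (nat_of_bool (i < n) = \sum_(k < n.+1 | k == i) (i < n))%N.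
  by rewrite big_pred1_eq.
have -> : (nat_of_bool (descent_pred s i)
           = \sum_(k < n.+1) (k.+1 == i) && descent s k)%N.
  case: (i : nat) iN => [|j] jn /=; first by rewrite big1.
  rewrite (bigD1 (Ordinal (ltnW jn))) //= eqxx big1 ?addn0 //.
  by move=> k; rewrite -val_eqE eqSS /= => /negPf->.
rewrite des_sum [X in (_ = _ + X)%N]big_mkcond -!big_split; apply: eq_bigr => k _ /=.
rewrite descent_lift -val_eqE /=.
have dm_k := dm k; have dm_pk := dm k.-1.
case: ltngtP => ki.
- rewrite addn0; case: descent => //=; by case: eqP.
- have -> : descent s k.-1 = false by apply/negP => /dm_pk; lia.
  have -> : descent s k = false by apply/negP => /dm_k; lia.
  by rewrite andbF.
have -> : descent s k = false by apply/negP => /dm_k; lia.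
by rewrite andbF addn0.
Qed.

(** For [i < n] the created descent at [i] is the last one. *)
Lemma desc_below_lift n (s : 'S_n) (i : 'I_n.+1) m : (m <= n)%N ->
  desc_below s i ->
  desc_below (lift_perm i ord_max s) m =
  if (i < n)%N then (i < m)%N else desc_below s m.
Proof.
move=> mn di; have iN := ltn_ord i.
apply/desc_belowP/idP => [dm|].
  case: ifP => i_n; first by apply: dm; rewrite descent_lift ltnn eqxx.
  apply/desc_belowP => k dk; have /desc_belowP/(_ _ dk) ki := di.
  by apply: dm; rewrite descent_lift ki dk; have := descent_lt dk; lia.
case: ifP => i_n dm k; rewrite descent_lift.
  case: ltngtP => ki; [by lia| |by lia].
  by have /desc_belowP/(_ k.-1) := di; lia.
case: ltngtP => ki; [|by move=> /descent_lt; lia| by rewrite i_n].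
by case/andP => /(desc_belowP _ _ dm).
Qed.

(** The position of the maximum and the remaining word determine the permutation; equal
    cardinalities give surjectivity. *)
Lemma sum_perm_lift (R : nmodType) n (F : 'S_n.+1 -> R) :
  \sum_s F s = \sum_i \sum_s F (lift_perm i ord_max s).
Proof.
rewrite pair_big /= (reindex (fun p : 'I_n.+1 * 'S_n => lift_perm p.1 ord_max p.2)) //.
apply: onW_bij; apply: inj_card_bij => [[i s] [j u] /= eq_su|]; last first.
  by rewrite card_prod !card_Sn card_ord factS.
have eq_ij : i = j.
  apply: (@perm_inj _ (lift_perm j ord_max u)).
  by rewrite -{1}eq_su !lift_perm_id.
congr (_, _); first by [].
apply/permP => k; apply: (@lift_inj _ ord_max).
by rewrite -(lift_perm_lift i) -(lift_perm_lift j) eq_su eq_ij.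
Qed.

(** * Recurrence for the descent polynomials Q_n(m) *)

Section DescentPoly.
Variables (R : comNzRingType) (t : R).

Definition despoly (n m : nat) : R :=
  \sum_(s : 'S_n | avoids321 s && desc_below s m) t ^+ des s.

Lemma despoly_full n m : (n.-1 <= m)%N ->
  despoly n m = \sum_(s in Av321 n) t ^+ des s.
Proof.
move=> nm; apply: eq_bigl => s; rewrite inE andb_idr // => _.
by apply/desc_belowP => k /descent_lt; lia.
Qed.

(* Contribution to despoly n.+1 of the insertions of the maximum at a position
   i < n: a descent is created, and the one just before position i, if any, is lost. *)
Definition despoly_ins (n i : nat) : R :=
  \sum_(s : 'S_n | avoids321 s && desc_below s i)
    t ^+ (des s + 1 - descent_pred s i).

(** Sort by the position [i] of the maximum: the end gives the first term, and any other [i] is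
    itself a descent, so [i < m]. *)
Lemma despoly_insert n m : (m <= n)%N ->
  despoly n.+1 m = despoly n m + \sum_(i < m) despoly_ins n i.
Proof.
move=> mn; rewrite /despoly big_mkcond sum_perm_lift big_ord_recr [LHS]addrC /=.
have des_max (s : 'S_n) : des (lift_perm ord_max ord_max s) = des s.
  have dn : desc_below s (@ord_max n).
    by apply/desc_belowP => k /descent_lt /=; lia.
  have := des_lift dn; rewrite /= ltnn addn0 => <-.
  have -> : descent_pred s n = false; last by rewrite addn0.
  by case: (n) s {dn} => //= k s; apply/negP => /descent_lt; rewrite ltnn.
congr (_ + _).
  rewrite [RHS]big_mkcond; apply: eq_bigr => s _.
  have dn : desc_below s (@ord_max n).
    by apply/desc_belowP => k /descent_lt /=; lia.
  by rewrite avoids321_lift dn andbT (desc_below_lift mn dn) /= ltnn des_max.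
rewrite (big_ord_widen _ _ mn) [RHS]big_mkcond; apply: eq_bigr => i _ /=.
set i' := widen_ord _ i; case: ifP => im; last first.
  rewrite big1 // => s _; rewrite avoids321_lift.
  have [di|] := boolP (desc_below s i'); last by rewrite andbF.
  by rewrite (desc_below_lift mn di) /= ltn_ord im !andbF.
rewrite /despoly_ins [RHS]big_mkcond; apply: eq_bigr => s _.
rewrite avoids321_lift -[nat_of_ord i]/(nat_of_ord i').
have [di|] := boolP (desc_below s i'); last by rewrite !andbF.
rewrite (desc_below_lift mn di) /= ltn_ord im !andbT; case: ifP => // _.
by have := des_lift di; rewrite /= ltn_ord => <-; rewrite addnK.
Qed.

Lemma desc_below0 n (s : 'S_n) : desc_below s 0 = (des s == 0%N).
Proof.
rewrite des_sum sum_nat_eq0; apply: eq_forallb => k /=.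
by case: descent.
Qed.

Lemma despoly_ins0 n : despoly_ins n 0 = t * despoly n 0.
Proof.
rewrite /despoly_ins /despoly mulr_sumr; apply: eq_bigr => s _ /=.
by rewrite subn0 addn1 exprS.
Qed.

Lemma desc_belowS n (s : 'S_n) i :
  desc_below s i.+1 && ~~ descent s i = desc_below s i.
Proof.
apply/andP/desc_belowP => [[/desc_belowP di si] k dk|di].
  have := di k dk; rewrite ltnS leq_eqVlt => /orP[/eqP ki|//].
  by rewrite -ki dk in si.
split; first by apply/desc_belowP => k /di /leqW.
by apply/negP => /di; rewrite ltnn.
Qed.

(** Words with a descent at [i] keep their weight; those without one, summing to Q_n(i), gain a
    factor [t]. *)
Lemma despoly_insS n i :
  despoly_ins n i.+1 = despoly n i.+1 + (t - 1) * despoly n i.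
Proof.
have split_last (F : 'S_n -> R) :
    \sum_(s : 'S_n | avoids321 s && desc_below s i.+1) F s =
    \sum_(s : 'S_n | avoids321 s && desc_below s i) F s +
    \sum_(s : 'S_n | avoids321 s && desc_below s i.+1 && descent s i) F s.
  rewrite (bigID (fun s : 'S_n => descent s i)) addrC; congr (_ + _).
  by apply: eq_bigl => s; rewrite -andbA desc_belowS.
rewrite /despoly_ins /despoly !split_last /=.
rewrite mulrBl mul1r addrC [RHS]addrC addrA subrK mulr_sumr addrC.
congr (_ + _); apply: eq_bigr => s.
  case/andP=> _; rewrite -desc_belowS => /andP[_ /negPf->].
  by rewrite subn0 addn1 exprS.
by case/andP=> _ ->; rewrite addnK.
Qed.

Lemma despoly0 n : despoly n 0 = 1.
Proof.
elim: n => [|n IHn]; last by rewrite despoly_insert // big_ord0 addr0.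
rewrite (despoly_full (leqnn _)) (bigD1 (1%g : 'S_0)) /=; last first.
  by rewrite inE; apply/avoids321P.
rewrite big1 ?addr0 => [|s /andP[_ /eqP[]]]; last by apply/permP => -[].
by rewrite des_sum big_ord0.
Qed.

(** Difference of two consecutive cases of [despoly_insert]. At [m = 0] it leaves t-1, whence the
    convention Q_n(-1) = 1. *)
Lemma despolyS n m : (m < n)%N ->
  despoly n.+1 m.+1 = despoly n.+1 m + despoly n m.+1
                      + (t - 1) * (if m is m'.+1 then despoly n m' else 1).
Proof.
move=> mn; rewrite !despoly_insert ?(ltnW mn) // big_ord_recr /=.
case: m mn => [|m] mn.
  by rewrite despoly_ins0 big_ord0 despoly0; ring.
by rewrite despoly_insS; ring.
Qed.

Lemma despoly_runpoly r m : despoly (m + r) m = runpoly (t - 1) r m.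
Proof.
suff main n k : (k <= n)%N -> despoly n k = runpoly (t - 1) (n - k) k.
  by rewrite main ?leq_addr // addKn.
elim: n k => [|n IHn] k; first by case: k => // _; rewrite despoly0 runpoly0.
elim: k => [|k IHk] kn; first by rewrite despoly0 runpoly0.
rewrite subSS; have [nk|nk|eq_kn] := ltngtP k n; last first.
(* The diagonal is outside the range of [despolyS]; both sides equal their values one step before
   it. *)
- subst k; rewrite subnn runpoly_diag -[1%N](subSnn n) -IHk //.
  by rewrite !(despoly_full (n := n.+1)).
- by lia.
have -> : (n - k = (n - k.+1).+1)%N by lia.
rewrite despolyS // runpolyS IHk ?IHn ?(ltnW kn) //.
have -> : (n.+1 - k = (n - k.+1).+2)%N by lia.
congr (_ + _ * _); case: k {IHk kn} nk => // k nk.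
by rewrite IHn ?(ltnW (ltnW nk)) //; congr runpoly; lia.
Qed.

Lemma sum_descents n :
  \sum_(s in Av321 n) t ^+ des s =
  \sum_(k < n.+1) ('C(n - k, k) * ballot (n - k) 1)%:R * (t - 1) ^+ k.
Proof.
rewrite -(despoly_full (leq_pred n)) -[X in despoly X n]addn0 despoly_runpoly.
apply: eq_bigr => k _; rewrite /runcoef mulnC.
by rewrite ballotS0 mul0n addn0.
Qed.

End DescentPoly.

(** * Reduction modulo 2 *)

Lemma sum_descents_pchar2 (R : comNzRingType) (t : R) m :
  2 \in [pchar R] -> let n := (2 ^ m - 1)%N in
  \sum_(s in Av321 n) t ^+ des s = (ballot n 1)%:R.
Proof.
move=> pchar2 n; rewrite sum_descents big_ord_recl big1 => [|j _].
  by rewrite addr0 mulr1 subn0 bin0 mul1n.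
apply/eqP; set k := lift _ _.
have [gt|le] := ltnP (n - k) k; first by rewrite bin_small ?mul0n ?mul0r.
rewrite natrM; suff /eqP-> : (ballot (n - k) 1)%:R == 0 :> R by rewrite mulr0 mul0r.
rewrite -(dvdn_pcharf pchar2) dvdn2 (odd_catalan (m := m)) // -/n.
(* [k >= 1] gives n-k < n, and [k <= n - k] gives n <= 2(n-k). *)
by have := ltn_ord j; rewrite /k /= /bump /= in le *; lia.
Qed.

Theorem theorem2p5 (m n : nat) (hn : n = (2 ^ m - 1)%N) :
  (A n 0).[1] = 1 /\
  (forall k : nat, (1 <= k)%N -> (2 %| (A n k).[1])%Z).
Proof.
split.
  rewrite A_at1_card -(despoly0 (1 : int) n) /despoly -sum1_card.
  rewrite -natz natr_sum; apply: eq_big => s; last by rewrite expr1n.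
  by rewrite !inE desc_below0.
move=> k k_gt0; have pchar2 := pchar_Fp (isT : prime 2).
rewrite A_at1_card dvdzE /= (dvdn_pcharf pchar2).
(* Taking [t = 'X] over F_2 turns the count for each [k] into a coefficient of a constant
   polynomial. *)
have pcharX : 2 \in [pchar {poly 'F_2}] by rewrite pchar_poly.
have /(congr1 (coefp k)) := sum_descents_pchar2 'X m pcharX.
rewrite -hn /= -polyC_natr coefC gtn_eqF // coef_sum => sum0.
rewrite -sum1_card natr_sum -[X in _ == X]sum0.
rewrite (eq_bigl (fun s => (s \in Av321 n) && (des s == k))); last first.
  by move=> s; rewrite inE.
rewrite big_mkcondr; apply/eqP/eq_bigr => s _.
by rewrite coefXn eq_sym; case: eqP.
Qed.
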